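(* Let $K$ be a metric space, $f:K\to\mathbb{C}$ a bounded function, $n$ a positive integer, and $(\delta_i)$ a sequence of positive real numbers of length at least $n$. If $\operatorname{os}_n(f,(\delta_i))\ne\emptyset$, then $$\|f\|_D\ \ge\ \sum_{i=1}^n\delta_i+\bigl\|f|\operatorname{os}_n(f,(\delta_i))\bigr\|_\infty .$$
   Context: $D(K)$ is the set of all $f:K\to\mathbb{C}$ of the form $f=(\varphi_1-\varphi_2)+i(\varphi_3-\varphi_4)$ with $\varphi_1,\dots,\varphi_4$ bounded real-valued lower semi-continuous functions on $K$. Equivalently, $f\in D(K)$ iff there is a sequence $(\varphi_j)$ of continuous complex-valued functions on $K$ with $\sup_{k\in K}\sum_j|\varphi_j(k)|<\infty$ and $f=\sum_j\varphi_j$ pointwise; $\|f\|_D$ is the infimum of $\sup_{k\in K}\sum_j|\varphi_j(k)|$ over all such sequences, and $\|f\|_D=\infty$ if $f\notin D(K)$. All $\limsup$'s are non-exclusive (the point itself is allowed). For $\varphi:K\to[-\infty,\infty]$, $U\varphi(x)=\limsup_{y\to x}\varphi(y)$. For $f$ complex-valued on a metric space, $\underline{\operatorname{osc}}f(x)=\limsup_{y\to x}|f(y)-f(x)|$ and $\operatorname{osc}f=U\,\underline{\operatorname{osc}}f$. For $\varepsilon\ge0$, $\operatorname{os}(f,\varepsilon)=\{x:\operatorname{osc}f(x)\ge\varepsilon\}$. Further $\operatorname{os}_1(f,(\delta_i))=\operatorname{os}(f,\delta_1)$ and, with $W=\operatorname{os}_j(f,(\delta_i))$, $\operatorname{os}_{j+1}(f,(\delta_i))=\operatorname{os}(f|W,\delta_{j+1})$,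 the oscillation of $f|W$ being computed in the metric subspace $W$. $\|g\|_\infty$ is the sup norm of $g$ on its domain. *)

(* Defs.v *)
From HB Require Import structures.
From mathcomp Require Export all_boot all_order all_algebra.
From mathcomp Require Export complex.
From mathcomp Require Export all_classical all_reals all_analysis.

Set Implicit Arguments.
Unset Strict Implicit.
Unset Printing Implicit Defensive.

Export Order.TTheory GRing.Theory Num.Theory.
Export numFieldNormedType.Exports.

Global Open Scope classical_set_scope.
Global Open Scope ring_scope.
Global Open Scope complex_scope.

(* R[i]^o is R[i] with its usual topology. Its library norm takes values in
   R[i], so moduli are written with the R-valued normc instead. *)
Notation modulus z := (ComplexField.Normc.normc z).

Section oscillation.
Context {R : realType} {T : topologicalType}.

(* Neighbourhoods of x contain x, so this limsup is the non-exclusive one. *)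
Definition upper_env (phi : T -> \bar R) (x : T) : \bar R :=
  limf_esup phi (nbhs x).

Definition lower_osc (f : T -> R[i]) (x : T) : \bar R :=
  limf_esup (fun y => (modulus (f y - f x))%:E) (nbhs x).

Definition osc (f : T -> R[i]) : T -> \bar R := upper_env (lower_osc f).

Definition os (f : T -> R[i]) (eps : R) : set T :=
  [set x | (eps%:E <= osc f x)%E].

End oscillation.

Section iterated_oscillation.
Context {R : realType} {T : topologicalType}.

(* The sequence delta is indexed from 1. The carrier of [subspace W] is T; at
   points of W its neighbourhoods are those of the subspace W, and points
   outside W are isolated, hence the intersection with W. The value at j = 0 is
   a convention that is never used for j > 0. *)
Fixpoint os_iter (f : T -> R[i]) (delta : nat -> R) (j : nat) : set T :=
  match j with
  | 0 => setT
  | j'.+1 =>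
      match j' with
      | 0 => os f (delta 1%N)
      | _.+1 =>
          let W := os_iter f delta j' in
          W `&` os (f : subspace W -> R[i]) (delta j)
      end
  end.

Definition sup_norm_on (f : T -> R[i]) (W : set T) : \bar R :=
  ereal_sup [set (modulus (f x))%:E | x in W].

End iterated_oscillation.

Section D_norm.
Context {R : realType} {K : topologicalType}.

Definition bounded_lsc (phi : K -> R) : Prop :=
  bounded_fun phi /\ lower_semicontinuous (EFin \o phi).

Definition D_class (f : K -> R[i]) : Prop :=
  exists phi1 phi2 phi3 phi4 : K -> R,
    [/\ bounded_lsc phi1, bounded_lsc phi2, bounded_lsc phi3,
        bounded_lsc phi4 &
        forall x, f x = (phi1 x - phi2 x) +i* (phi3 x - phi4 x)].

Definition sup_sum (phi : nat -> K -> R[i]) : \bar R :=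
  ereal_sup (range (fun k => \sum_(0 <= j <oo) (modulus (phi j k))%:E)%E).

Definition D_representation (f : K -> R[i]) (phi : nat -> K -> R[i]) : Prop :=
  [/\ forall j, continuous (phi j : K -> R[i]^o),
      (sup_sum phi < +oo)%E &
      forall k, (fun m => \sum_(0 <= j < m) phi j k : R[i]^o) @ \oo --> (f k : R[i]^o)].

Definition D_norm (f : K -> R[i]) : \bar R :=
  if `[< D_class f >]
  then ereal_inf [set sup_sum phi | phi in D_representation f]
  else +oo%E.

End D_norm.

(* Main.v *)
Require Import Defs.
From mathcomp Require Import ring lra.

Set Implicit Arguments.
Unset Strict Implicit.
Unset Printing Implicit Defensive.

(** Suppose [x] lies in [os_iter f delta j.+1], [f] is the pointwise sum of
    continuous [phi i], and [\sum_(i < m) |phi i x| > c].  By continuity this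
    persists near [x].  Pick [y] and then [z] in [os_iter f delta j], close to
    [x], with [|f z - f y| > delta - e] and [z] so close to [y] that a long
    partial sum, nearly equal to [f y] at [y], hardly changes from [y] to [z].
    The oscillation is then carried by the tail at [z], so that
    [\sum_i |phi i z| > c + delta - e].  Iterating down to [j = 0] collects all
    the [delta]'s on top of [c], where [c] is arbitrarily close to [|f x|]. *)

Section lower_bound.
Context {R : realType}.
Implicit Types a b : R[i].

Lemma normr_normc a : `|a| = (modulus a)%:C.
Proof. by case: a. Qed.

Lemma modulus_ge0 a : 0 <= modulus a.
Proof. by case: a => x y; exact: sqrtr_ge0. Qed.

Lemma modulusD a b : modulus (a + b) <= modulus a + modulus b.
Proof. by rewrite -lecR rmorphD /= -!normr_normc ler_normD. Qed.

Lemma modulusBC a b : modulus (a - b) = modulus (b - a).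
Proof. by apply: complexI; rewrite -!normr_normc distrC. Qed.

Lemma modulus_sub_triangle a b : modulus a - modulus b <= modulus (a - b).
Proof. by rewrite lerBlDr (le_trans _ (modulusD _ _)) ?subrK. Qed.

Lemma modulus_sum (I : Type) (r : seq I) (F : I -> R[i]) :
  modulus (\sum_(i <- r) F i) <= \sum_(i <- r) modulus (F i).
Proof.
elim/big_rec2: _ => [|i u v _ vu]; first by rewrite ComplexField.Normc.normc0.
by rewrite (le_trans (modulusD _ _))// lerD2l.
Qed.

Lemma cvg_sumr {k : numFieldType} {V : normedModType k} {I J : Type}
    (F : set_system I) {FF : Filter F} (r : seq J) (g : J -> I -> V)
    (a : J -> V) :
  (forall i, g i t @[t --> F] --> a i) ->
  \sum_(i <- r) g i t @[t --> F] --> \sum_(i <- r) a i.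
Proof. by move=> ga; apply: cvg_big => //; exact: add_continuous. Qed.

Lemma cvg_modulus_lt {I : Type} (F : set_system I) {FF : Filter F}
    (g : I -> R[i]) a (e : R) :
  (g : I -> R[i]^o) @ F --> (a : R[i]^o) -> 0 < e ->
  \forall t \near F, modulus (a - g t) < e.
Proof.
move=> /cvgrPdist_lt ga e0; have /ga : 0 < e%:C by rewrite ltcR.
by apply: filterS => t; rewrite normr_normc ltcR.
Qed.

Lemma cvg_modulus {I : Type} (F : set_system I) {FF : Filter F}
    (g : I -> R[i]) a :
  (g : I -> R[i]^o) @ F --> (a : R[i]^o) ->
  modulus (g t) @[t --> F] --> modulus a.
Proof.
move=> ga; apply/cvgrPdist_lt => e e0.
apply: filterS (cvg_modulus_lt ga e0) => t /(le_lt_trans _); apply.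
by rewrite ler_norml modulus_sub_triangle andbT lerNl opprB modulusBC
  modulus_sub_triangle.
Qed.

Section oscillation.
Context {T : topologicalType}.

Lemma limf_esup_ge (g : T -> \bar R) (F : set_system T) (d e : \bar R)
    (A : set T) :
  (d <= limf_esup g F)%E -> F A -> (e < d)%E -> exists2 y, A y & (e < g y)%E.
Proof.
move=> dg FA ed.
have : (e < ereal_sup (g @` A))%E.
  apply: (lt_le_trans ed); apply: (le_trans dg).
  by apply: ereal_inf_lbound; exists A.
by move=> /ereal_sup_gt[_ [y Ay <-] ?]; exists y.
Qed.

(** [osc] is a limsup of limsups: the outer one supplies [y] near [x] with large [lower_osc f y],
    the inner one supplies [z] arbitrarily close to that fixed [y]. *)
Lemma os_near (f : T -> R[i]) (d e : R) (x : T) (A : set T) :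
  os f d x -> nbhs x A -> e < d ->
  exists2 y, A y & forall B, nbhs y B ->
    exists2 z, B z & e < modulus (f z - f y).
Proof.
(* Each limsup yields only values above a strictly smaller bound, so the descent from [d] to [e]
   passes through a midpoint. *)
move=> dx xA ed; pose h := (e + d) / 2.
have [eh hd] : e < h /\ h < d by rewrite /h; split; lra.
have [y Ay hy] := limf_esup_ge dx xA (hd : (h%:E < d%:E)%E).
exists y => // B yB.
have [z Bz] := limf_esup_ge (ltW hy) yB (eh : (e%:E < h%:E)%E).
by rewrite lte_fin; exists z.
Qed.

End oscillation.

Section iterated_oscillation.
Context {K : topologicalType}.

Lemma os_iterS_near (f : K -> R[i]) (delta : nat -> R) (j : nat) (e : R)
    (x : K) (A : set K) :
  os_iter f delta j.+1 x -> nbhs x A -> e < delta j.+1 ->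
  exists2 y, A y & forall B, nbhs y B ->
    exists2 z, (os_iter f delta j `&` B) z & e < modulus (f z - f y).
Proof.
case: j => [|j].
  move=> dx xA ed; have [y Ay Hy] := os_near dx xA ed.
  by exists y => // B /Hy[z Bz ?]; exists z.
rewrite [os_iter _ _ j.+2]/=; set W := os_iter f delta j.+1 => -[Wx dx] xA ed.
(* At points of [W], traces on [W] of neighbourhoods in [K] are neighbourhoods in the subspace; this
   keeps both [y] and [z] inside [W]. *)
have sub t B : W t -> nbhs t B -> nbhs (t : subspace W) (W `&` B).
  move=> Wt tB; apply/(nbhs_subspace_ex _ Wt); exists B => //.
  by rewrite setIAC setIid setIC.
have [y [Wy Ay] Hy] := os_near dx (sub _ _ Wx xA) ed.
by exists y => // B /(sub _ _ Wy)/Hy.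
Qed.

Section pointwise_sum.
Variables (f : K -> R[i]) (phi : nat -> K -> R[i]).
Hypothesis phi_cont : forall i, continuous (phi i : K -> R[i]^o).
Hypothesis phi_cvg : forall k,
  (fun m => \sum_(0 <= i < m) phi i k : R[i]^o) @ \oo --> (f k : R[i]^o).

Lemma os_iterS_partial_sum (delta : nat -> R) (j m : nat) (c d : R) (x : K) :
  os_iter f delta j.+1 x -> c < \sum_(0 <= i < m) modulus (phi i x) ->
  d < delta j.+1 ->
  exists z m', os_iter f delta j z /\
    c + d < \sum_(0 <= i < m') modulus (phi i z).
Proof.
(* Three errors below [e] will occur: two from truncating the series at [y] and at [z], one from
   moving between them. A quarter of the gap leaves room for all three. *)
move=> xW cx dd; pose e := (delta j.+1 - d) / 4.
have e0 : 0 < e by rewrite /e; lra.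
pose A := [set z | c < \sum_(0 <= i < m) modulus (phi i z)].
have xA : nbhs x A.
  apply: cvgr_gt cx; apply: (@cvg_sumr R R^o) => i.
  by apply: cvg_modulus; exact: phi_cont.
have de : d + 3 * e < delta j.+1 by rewrite /e; lra.
(* With [y] in the interior of [A], points [z] close enough to [y] also lie in [A]. *)
have [y Ay Hy] := os_iterS_near xW (nbhs_interior xA) de.
(* Taking [M] at least [m] keeps the first [m] terms, worth more than [c], disjoint from the tail
   starting at [M], which will be worth more than [d]. *)
have [M mM yM] : exists2 M, (m <= M)%N &
    modulus (f y - \sum_(0 <= i < M) phi i y) < e.
  have [M _ HM] := cvg_modulus_lt (@phi_cvg y) e0.
  by exists (maxn m M); [exact: leq_maxl|apply: HM; exact: leq_maxr].
have yB : \forall z \near y, modulus (\sum_(0 <= i < M) phi i y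
    - \sum_(0 <= i < M) phi i z) < e.
  apply: cvg_modulus_lt => //; apply: (@cvg_sumr R[i] R[i]^o) => i.
  exact: phi_cont.
have [z [Wz [/interior_subset Az yz]] fzy] := Hy _ (filterI (open_nbhs_nbhs (conj (@open_interior _ A) Ay)) yB).
have [M' MM' zM'] : exists2 M', (M <= M')%N &
    modulus (f z - \sum_(0 <= i < M') phi i z) < e.
  have [M' _ HM'] := cvg_modulus_lt (@phi_cvg z) e0.
  by exists (maxn M M'); [exact: leq_maxl|apply: HM'; exact: leq_maxr].
exists z, M'; split=> //.
rewrite (big_cat_nat (n := M))//= (big_cat_nat (n := m) (p := M))//=.
have := modulus_sum (index_iota M M') (phi^~ z).
have : 0 <= \sum_(m <= i < M) modulus (phi i z).
  by apply: sumr_ge0 => i _; exact: modulus_ge0.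
move: Az zM'; rewrite /A/= (big_cat_nat (n := M) (p := M'))//=.
move: yM yz fzy.
set s := \sum_(0 <= i < M) phi i z; set t := \sum_(M <= i < M') phi i z.
set u := \sum_(0 <= i < M) phi i y => yM yz fzy.
(* All terms on the right except [modulus t] are below [e], while the left side exceeds [d + 3 * e];
   hence [modulus t] exceeds [d]. *)
have : modulus (f z - f y) <= modulus (f z - (s + t)) + modulus t
    + modulus (u - s) + modulus (f y - u).
  rewrite (_ : f z - f y = f z - (s + t) + t + (s - u) + (u - f y)); last first.
    by ring.
  rewrite (modulusBC u s) (modulusBC (f y)).
  by do 2 (rewrite (le_trans (modulusD _ _))// lerD2r); exact: modulusD.
by lra.
Qed.

(** Induction on [j] with [m], [c] and [x] free: each descent replaces [c] by [c + (delta j.+1 - e)]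
    at a new point, and [e] is sent to zero level by level. *)
Lemma os_iter_partial_sum_le (delta : nat -> R) (S : \bar R) (j m : nat)
    (c : R) (x : K) :
  (forall k p, ((\sum_(0 <= i < p) modulus (phi i k))%:E <= S)%E) ->
  os_iter f delta j x -> c < \sum_(0 <= i < m) modulus (phi i x) ->
  ((\sum_(1 <= i < j.+1) delta i + c)%:E <= S)%E.
Proof.
move=> phiS; elim: j m c x => [|j IH] m c x xW cx.
  by rewrite big_geq// add0r (le_trans _ (phiS x m))// lee_fin ltW.
apply/lee_subgt0Pr => e e0.
have de : delta j.+1 - e < delta j.+1 by lra.
have [z [m' [zW cz]]] := os_iterS_partial_sum xW cx de.
apply: le_trans (IH _ _ _ zW cz).
by rewrite big_nat_recr//= -EFinB lee_fin; lra.
Qed.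

End pointwise_sum.

Lemma partial_sum_le_sup_sum (phi : nat -> K -> R[i]) (k : K) (p : nat) :
  ((\sum_(0 <= i < p) modulus (phi i k))%:E <= sup_sum phi)%E.
Proof.
rewrite -sumEFin; apply: (@le_trans _ _
    (\sum_(0 <= i <oo) (modulus (phi i k))%:E)%E).
  by apply: nneseries_lim_ge => i _; rewrite lee_fin modulus_ge0.
by apply: ereal_sup_ubound; exists k.
Qed.

End iterated_oscillation.
End lower_bound.

Theorem lemma1p8 (R : realType) (K : metricType R) (f : K -> R[i])
  (bounded_f : bounded_fun (f : K -> R[i]^o))
  (n : nat) (n_gt0 : (0 < n)%N)
  (delta : nat -> R)
  (delta_gt0 : forall i, (1 <= i <= n)%N -> 0 < delta i)
  (os_neq0 : os_iter f delta n !=set0) :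
  ((\sum_(1 <= i < n.+1) delta i)%:E + sup_norm_on f (os_iter f delta n)
     <= D_norm f)%E.
Proof.
rewrite /D_norm; case: asboolP => _; last exact: leey.
apply: le_ereal_inf_tmp => _ [phi [phi_cont _ phi_cvg] <-].
rewrite addeC -leeBrDr//; apply: ge_ereal_sup => _ [x xW <-].
rewrite leeBrDr//; apply/lee_subgt0Pr => e e0.
(* The descent starts from a strict bound on a finite sum, so [modulus (f x)] is first lowered by
   [e]. *)
have [m _ /(_ _ (leqnn m)) xm] := cvg_modulus_lt (phi_cvg x) e0.
have cx : modulus (f x) - e < \sum_(0 <= i < m) modulus (phi i x).
  have := modulus_sub_triangle (f x) (\sum_(0 <= i < m) phi i x).
  by have := modulus_sum (index_iota 0 m) (phi^~ x); lra.
apply: le_trans (os_iter_partial_sum_le phi_cont phi_cvg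
  (@partial_sum_le_sup_sum _ _ phi) xW cx).
by rewrite lee_fin; lra.
Qed.
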